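(* Let $G$ be a finite, simple, undirected, connected graph without isolated vertices, and let ${\sf pw}(G)$ denote the pathwidth of $G$. Then there exists a CFON coloring of $G$ using at most $\left\lfloor \frac{5}{3}({\sf pw}(G)+1)\right\rfloor$ colors; that is, $\chi_{ON}(G)\le \left\lfloor \frac{5}{3}({\sf pw}(G)+1)\right\rfloor$.
   Context: A CFON coloring (conflict-free coloring on open neighborhoods) of a graph $G=(V,E)$ using $k$ colors is an assignment $C:V(G)\to\{1,\dots,k\}$ such that for every $v\in V(G)$ there exists $i\in\{1,\dots,k\}$ with $|N(v)\cap C^{-1}(i)|=1$, where $N(v)$ is the open neighborhood of $v$ (the set of vertices adjacent to $v$). $\chi_{ON}(G)$ is the smallest number of colors required for a CFON coloring of $G$. A path decomposition of $G$ is a sequence $(X_1,\dots,X_s)$ of subsets of $V(G)$ (bags) such that every vertex lies in some bag, every edge has both endpoints in some common bag, and if $v\in X_{p_1}\cap X_{p_2}$ with $p_1\le p_2$ then $v\in X_p$ for all $p_1\le p\le p_2$. Its width is $\max_p(|X_p|-1)$, and ${\sf pw}(G)$ is the minimum width over all path decompositions of $G$. *)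

(* Defs.v *)
From mathcomp Require Import all_boot.
From mathcomp Require Import boolp.

Set Implicit Arguments.
Unset Strict Implicit.
Unset Printing Implicit Defensive.

(* A finite simple graph is a symmetric irreflexive relation [e] on a finite
   type [T] of vertices. *)
Section Graph.
Variables (T : finType) (e : rel T).

Definition open_nbh (v : T) : {set T} := [set u | e v u].

Definition no_isolated : Prop := forall v : T, exists u : T, e v u.

(* The empty graph is not counted as connected. *)
Definition connected_graph : Prop :=
  0 < #|T| /\ forall x y : T, connect e x y.

(* The palette {1, ..., k} is ['I_k]; not every color has to be used. *)
Definition CFON_coloring (k : nat) (C : {ffun T -> 'I_k}) : bool :=
  [forall v, exists i, #|open_nbh v :&: C @^-1: [set i]| == 1].

Definition CFON_colorable (k : nat) : bool :=
  [exists C : {ffun T -> 'I_k}, CFON_coloring C].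

(* A graph with an isolated vertex has no CFON coloring, so the minimum
   defining [chi_ON] needs [no_isolated]; coloring injectively then works. *)
Lemma CFON_colorable_ex : no_isolated -> exists k, CFON_colorable k.
Proof.
move=> noiso; exists #|T|; apply/existsP; exists [ffun v => enum_rank v].
apply/forallP => v; have [u evu] := noiso v.
apply/existsP; exists (enum_rank u); apply/cards1P; exists u.
apply/setP => w; rewrite !inE ffunE (inj_eq enum_rank_inj).
by case: eqP => [->|_]; rewrite ?evu ?andbF.
Qed.

Definition chi_ON (noiso : no_isolated) : nat :=
  ex_minn (CFON_colorable_ex noiso).

Record path_decomposition (X : seq {set T}) : Prop := PathDecomposition {
  pd_vertex : forall v : T, exists2 A, A \in X & v \in A;
  pd_edge : forall u v : T, e u v -> exists2 A, A \in X & (u \in A) && (v \in A);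
  pd_interval : forall (v : T) (p1 p p2 : nat), p1 <= p <= p2 -> p2 < size X ->
    v \in nth set0 X p1 -> v \in nth set0 X p2 -> v \in nth set0 X p
}.

(* Truncation of [#|A|.-1] at an empty bag is harmless as soon as [T] is
   nonempty, since some bag is then nonempty. *)
Definition pd_width (X : seq {set T}) : nat := \max_(A <- X) #|A|.-1.

Definition has_pd_of_width (w : nat) : bool :=
  `[< exists2 X, path_decomposition X & pd_width X = w >].

Lemma has_pd_of_width_ex : exists w, has_pd_of_width w.
Proof.
exists (pd_width [:: [set: T]]); apply/asboolP; exists [:: [set: T]] => //.
split=> [v|u v _|v p1 p p2 /andP[_ lep]]; first by exists setT; rewrite !inE.
  by exists setT; rewrite !inE.
by case: p2 lep => [|//]; rewrite leqn0 => /eqP->.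
Qed.

Definition pathwidth : nat := ex_minn has_pd_of_width_ex.

End Graph.

(* Main.v *)
Require Import Defs.
From mathcomp Require Import all_boot.
From mathcomp Require Import boolp zify.

Set Implicit Arguments.
Unset Strict Implicit.
Unset Printing Implicit Defensive.

(* Process the vertices along the bags, each vertex being active from the
   first to the last bag that it shares with a neighbor, and give each vertex v
   a fixed witness W v in N(v). A new vertex z must avoid the colors of the
   active vertices and the witness colors of its active neighbors. It reuses
   the witness color of another active vertex when this is possible, and takes
   a fresh color otherwise. Two bounds hold for the colors in use when z is
   processed: let a be the last active vertex whose witness is gone and whose
   color is not a witness color of such a vertex. When a was processed, no
   reuse was possible, so each witness color of the older vertices R0 that are
   still active was the color of an active vertex or the witness color of a
   neighbor of a. The neighbors of a among the older vertices have all been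
   dropped since, so that every dropped vertex pays for at most two such
   colors. With w the maximal bag size, at most w - 1 - |R0| vertices were
   dropped, which yields at most w - 1 + min (|R0| + 1, 2 (w - 1 - |R0|)) <= w
   - 1 + 2 w / 3 colors. *)

(** * Witnesses and active vertices *)

Section GreedyColoring.

(** A vertex [v] lives from bag [tau v] to bag [r v]; [pos] is the processing order and [w] bounds
    the load of a bag. *)
Variables (T : finType) (e : rel T) (tau r pos : T -> nat) (w : nat).
Hypothesis esym : symmetric e.
Hypothesis eirr : irreflexive e.
Hypothesis pos_inj : injective pos.
Hypothesis pos_tau : forall a b, pos a < pos b -> tau a <= tau b.
Hypothesis tau_le_r : forall v, tau v <= r v.
Hypothesis adj_tau_r : forall u v, e u v -> tau u <= r v.
Hypothesis load : forall t, #|[set v | tau v <= t <= r v]| <= w.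
Hypothesis needy_next : forall v a, pos v < pos a ->
  (forall y, e v y -> pos a <= pos y) -> e v a.

(* Choosing the earlier neighbor with the latest end makes the witness outlive
   all other earlier neighbors of [v]. *)
Definition is_witness v y :=
  [/\ e v y,
      forall x, e v x -> pos x < pos v -> pos y < pos v /\ r x <= r y
    & pos v <= pos y -> forall x, e v x -> pos y <= pos x].

Lemma witness_ex : no_isolated e -> exists W, forall v, is_witness v (W v).
Proof.
move=> noiso; apply: fin_all_exists => v; rewrite /is_witness.
have [y0 /andP[evy0 y0v]|none] := pickP [pred y | e v y && (pos y < pos v)].
  pose P y := e v y && (pos y < pos v).
  have Py0 : P y0 by rewrite /P evy0.
  case: (@arg_maxnP _ y0 P r Py0) => y /andP[evy yv] ymax.
  exists y; split=> // [x evx xv|vy].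
    by split=> //; apply: ymax; rewrite /P evx.
  by move: yv; rewrite ltnNge vy.
have [u evu] := noiso v.
case: (@arg_minnP _ u (e v) pos evu) => y evy ymin.
exists y; split=> // x evx xv.
by have := none x; rewrite /= evx xv.
Qed.

Variable W : T -> T.
Hypothesis WP : forall v, is_witness v (W v).

Definition active z := [set v | (pos v < pos z) && (tau z <= r v)].
Definition ready v z := pos (W v) < pos z.

(** The witness of [v] either precedes [v] or is the first of all its neighbors. *)
Lemma ready_adj v x a : e v x -> pos x < pos a -> pos v < pos a -> ready v a.
Proof.
case: (WP v) => _ W1 W2 evx xa va; rewrite /ready.
have [vx|xv] := leqP (pos v) (pos x); last first.
  by have [] := W1 _ evx xv; move=> /ltn_trans/(_ va).
have [/W2/(_ _ evx)|/ltn_trans/(_ va)//] := leqP (pos v) (pos (W v)).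
by move=> /leq_ltn_trans; apply.
Qed.

Lemma card_active z : #|active z| < w.
Proof.
apply: leq_trans (load (tau z)).
have zA : z \notin active z by rewrite inE ltnn.
rewrite -add1n -[1](cards1 z) -cardsUI.
rewrite (_ : [set z] :&: active z = set0) ?cards0 ?addn0; last first.
  by apply/eqP; rewrite setI_eq0 disjoints1.
apply: subset_leq_card; apply/subsetP => v; rewrite !inE => /orP[/eqP->|].
  by rewrite leqnn tau_le_r.
by case/andP => /pos_tau -> ->.
Qed.

(** * Counting the colors in use *)

Section Palette.

Variable k : nat.
Implicit Type C : T -> 'I_k.

Definition forbidden C z :=
  C @: active z :|: [set C (W v) | v in active z & ready v z && e v z].

Definition used C z :=
  C @: active z :|: [set C (W v) | v in active z & ready v z].

(* Reusing the witness color of the vertex that stays active for longest keeps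
   the color shared for as long as any other choice would have been useful. *)
Definition greedy C z :=
  C z \notin forbidden C z /\
  forall v, v \in active z -> ready v z -> C (W v) \notin forbidden C z ->
  exists u, [/\ u \in active z, ready u z, r v <= r u & C z = C (W u)].

Lemma greedy_active C a v : greedy C a -> v \in active a -> C v != C a.
Proof.
move=> [+ _] va; rewrite inE negb_or => /andP[+ _].
by apply: contraNneq => <-; apply: imset_f.
Qed.

Lemma used_bound C z : (forall a, pos a < pos z -> greedy C a) ->
  #|used C z| < 5 * w %/ 3.
Proof.
move=> grC.
set B := active z.
(* [X]: the vertices whose witness is no longer active. *)
pose X := [set v in B | ready v z && (W v \notin B)].
pose U v := C (W v).
have usedX : used C z = C @: B :|: U @: X.
  apply/setP => c; rewrite !inE; have [//|cB] := boolP (c \in C @: B).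
  apply/imsetP/imsetP => -[v]; rewrite inE => /andP[vB].
    move=> rv cE; exists v => //; rewrite inE vB rv /=.
    by apply: contra cB => WB; rewrite cE imset_f.
  by case/andP => rv _ ->; exists v => //; rewrite inE vB.
have Bw : #|B| < w := card_active z.
(* If every vertex of [X] has a color in [U @: X], there is one color per
   active vertex. Otherwise look back at the step of the last exception [a]. *)
pose F := [set v in X | C v \notin U @: X].
have [F0|[a0 a0F]] := set_0Vmem F.
  have sub : used C z \subset C @: (B :\: X) :|: U @: X.
    rewrite usedX; apply/subsetP => c; rewrite !inE => /orP[|->]; last first.
      by rewrite orbT.
    case/imsetP => v vB ->; have [vX|vX] := boolP (v \in X).
      have : v \notin F by rewrite F0 inE.
      by rewrite inE vX /= negbK => ->; rewrite orbT.
    by rewrite imset_f // inE vX.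
  have XB : X \subset B by apply/subsetP => v; rewrite inE => /andP[].
  have := subset_leq_card sub; have := cardsUI (C @: (B :\: X)) (U @: X).
  have := leq_imset_card C (B :\: X); have := leq_imset_card U X.
  have := cardsD B X; rewrite (setIidPr XB).
  have := subset_leq_card XB; lia.
case: (@arg_maxnP _ a0 (mem F) pos a0F) => a + amax {a0 a0F}.
rewrite /=; move=> /[dup] aF; rewrite inE => /andP[aX aU].
move: (aX); rewrite inE => /andP[aB /andP[ra WaB]].
move: (aB); rewrite inE => /andP[az zra].
have tau_az : tau a <= tau z by exact: pos_tau.
pose R0 := [set v in B | pos v < pos a].
pose R1 := [set v in B | pos a < pos v].
have cardB : #|B| = #|R0| + #|R1| + 1.
  have -> : B = a |: (R0 :|: R1).
    apply/setP => v; rewrite in_setU1 in_setU !in_set.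
    have [->|va] := eqVneq v a; first by rewrite az zra.
    rewrite -andb_orr -neq_ltn.
    by rewrite (contra_neq (@pos_inj _ _) va) andbT.
  rewrite cardsU1 !inE !ltnn !andbF /= add1n addn1; congr _.+1.
  rewrite cardsU (_ : R0 :&: R1 = set0) ?cards0 ?subn0 //.
  apply/setP => v; rewrite !inE; lia.
have R0a : R0 \subset active a.
  apply/subsetP => v; rewrite !inE => /andP[/andP[_ zr] ->] /=.
  exact: leq_trans zr.
pose M := active a :\: R0.
have cardM : #|R0| + #|M| < w.
  rewrite cardsD (setIidPr R0a) subnKC ?card_active //.
  exact: subset_leq_card.
(* A neighbor of [a] in [R0] would be outlived by [W a], which would then still be active. *)
have R0n v : v \in R0 -> ~~ e a v.
  rewrite !inE => /andP[/andP[vz zr] va]; apply: contra WaB => eav.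
  have [_ /(_ _ eav va)[Wa rW] _] := WP a.
  by rewrite inE (ltn_trans Wa az) (leq_trans zr rW).
(* If [v] had no neighbor before [a], the order would make [a] adjacent to it, against [R0n]. *)
have R0ready v : v \in R0 -> ready v a.
  move=> vR; have [|nr] := boolP (ready v a); first by [].
  have := R0n v vR; rewrite esym needy_next //.
    by move: vR; rewrite !inE => /andP[].
  move=> y evy; rewrite leqNgt; apply: contra nr => ya.
  apply: (ready_adj evy) => //; by move: vR; rewrite !inE => /andP[].
(* Otherwise [a] would have reused the witness color of a vertex outliving [v],
   hence lying in [X]. *)
have key v : v \in R0 -> v \in X -> U v \in forbidden C a.
  move=> vR vX; apply: contraT => nf.
  have [_ /(_ v (subsetP R0a _ vR) (R0ready v vR) nf)] := grC a az.
  case=> u [ua ru rvu CaU].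
  move: (vR); rewrite !inE => /andP[/andP[vz zrv] va].
  move: (ua); rewrite inE => /andP[upa tar].
  have uB : u \in B by rewrite inE (ltn_trans upa az) (leq_trans zrv rvu).
  move: aU; rewrite CaU imset_f // inE uB [ready u z](ltn_trans ru az) /=.
  apply/negP; rewrite inE => /andP[_ zrW].
  have /(greedy_active (grC a az)) : W u \in active a.
    by rewrite inE [pos _ < _]ru (leq_trans tau_az zrW).
  by rewrite -CaU eqxx.
(* The colors due to the vertices up to [a] lie in [D + C a]; a later vertex
   adds one color only, as it is not in [F]. *)
pose D := C @: R0 :|: U @: (X :&: R0) :|: [set U a].
pose g v := if v \in X then U v else C v.
have usedD : used C z \subset D :|: [set C a] :|: g @: R1.
  have dich v : v \in B -> [\/ v \in R0, v = a | v \in R1].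
    move=> vB; have [va|av|va] := ltngtP (pos v) (pos a).
    - by apply: Or31; rewrite inE vB.
    - by apply: Or33; rewrite inE vB.
    - by apply: Or32; apply: pos_inj.
  have UX : U @: X \subset D :|: [set C a] :|: g @: R1.
    apply/subsetP => c /imsetP[v vX ->].
    have vB : v \in B by move: vX; rewrite inE => /andP[].
    case: (dich v vB) => [vR|->|vR].
    - by rewrite /D !in_setU (@imset_f _ _ U) ?orbT // inE vX.
    - by rewrite /D !in_setU set11 !orbT.
    - rewrite in_setU (_ : U v = g v) ?imset_f ?orbT //.
      by rewrite /g vX.
  rewrite usedX; apply/subsetP => c; rewrite in_setU => /orP[|/(subsetP UX)//].
  case/imsetP => v vB ->; case: (dich v vB) => [vR|->|vR].
  - by rewrite /D !in_setU imset_f.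
  - by rewrite !in_setU set11 !orbT.
  have [vX|vX] := boolP (v \in X); last first.
    rewrite in_setU (_ : C v = g v) ?imset_f ?orbT //.
    by rewrite /g (negPf vX).
  have /(subsetP UX)// : C v \in U @: X.
  apply: contraT => vU; have vF : v \in F by rewrite inE vX.
  by move: vR; rewrite inE ltnNge => /andP[_ /negP[]]; apply: amax.
have D2 : #|D| <= 2 * #|R0| + 1.
  rewrite /D; have := cardsUI (C @: R0 :|: U @: (X :&: R0)) [set U a].
  have := cardsUI (C @: R0) (U @: (X :&: R0)).
  have := leq_imset_card C R0; have := leq_imset_card U (X :&: R0).
  have := subset_leq_card (subsetIr X R0).
  rewrite cards1; lia.
(* Each vertex of [M] had to be dropped since; it accounts for at most two of
   the witness colors of [R0]: its own color and, if adjacent to [a], its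
   witness color. *)
have DM : D \subset C @: R0 :|: C @: M :|: U @: [set v in M | e a v]
                      :|: [set U a].
  apply/subsetP => c; rewrite !in_setU => /orP[/orP[->//|]|->]; last first.
    by rewrite orbT.
  case/imsetP => v /setIP[vX vR] ->; move: (key v vR vX).
  rewrite in_setU => /orP[] /imsetP[u ua ->].
    have [uR|uR] := boolP (u \in R0); first by rewrite imset_f.
    have -> : C u \in C @: M by apply: imset_f; rewrite inE uR.
    by rewrite orbT.
  move: ua; rewrite inE => /and3P[ua _ eua].
  have uR : u \notin R0 by apply/negP => /R0n; rewrite esym eua.
  have -> : C (W u) \in U @: [set v in M | e a v].
    by apply: (@imset_f _ _ U); rewrite inE inE uR ua esym.
  by rewrite orbT.
have card1 : #|used C z| <= #|D| + 1 + #|R1|.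
  apply: leq_trans (subset_leq_card usedD) _.
  have := cardsUI (D :|: [set C a]) (g @: R1); have := cardsUI D [set C a].
  rewrite cards1; have := leq_imset_card g R1; lia.
(* If [a] has an earlier neighbor, then [W a] is in [M] and [U a] is already counted; otherwise [a]
   has no neighbor in [M], and [U a] is the only extra color. *)
have [[y ya eay]|none] :
    (exists2 y, pos y < pos a & e a y) \/ (forall y, e a y -> pos a <= pos y).
  have [y /andP[]|none] := pickP [pred y | (pos y < pos a) && e a y].
    by left; exists y.
  right=> y eay; rewrite leqNgt; apply/negP => ya.
  by have := none y; rewrite /= ya eay.
- have UaM : U a \in C @: M.
    have [eaW /(_ _ eay ya)[Wa _] _] := WP a.
    apply: imset_f; rewrite inE; apply/andP; split.
      by apply: contra WaB; rewrite inE => /andP[].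
    by rewrite inE Wa adj_tau_r.
  have {}DM : D \subset C @: R0 :|: C @: M :|: U @: [set v in M | e a v].
    apply/subsetP => c /(subsetP DM); rewrite in_setU => /orP[//|].
    by rewrite in_set1 => /eqP ->; rewrite !in_setU UaM orbT.
  have sM : [set v in M | e a v] \subset M.
    by apply/subsetP => v; rewrite inE => /andP[].
  have cD : #|D| <= #|R0| + #|M| + #|M|.
    apply: leq_trans (subset_leq_card DM) _.
    apply: leq_trans (leq_card_setU _ _) _.
    apply: leq_add; last first.
      exact: leq_trans (leq_imset_card _ _) (subset_leq_card sM).
    apply: leq_trans (leq_card_setU _ _) _.
    by apply: leq_add; apply: leq_imset_card.
  (* Twice [D2] plus [cD] gives [3 * (#|D| - #|R0|) <= 2 * w], by [cardM]. *)
  move: D2 cD cardM cardB Bw card1.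
  move: #|D| #|R0| #|M| #|R1| #|B| #|used C z| => *; lia.
- have M0 : [set v in M | e a v] = set0.
    apply/setP => v; rewrite !inE; apply/negP => /andP[].
    case/andP => _ /andP[va _] /none; by rewrite leqNgt va.
  have cD : #|D| <= #|R0| + #|M| + 1.
    apply: leq_trans (subset_leq_card DM) _; rewrite M0 imset0 setU0.
    apply: leq_trans (leq_card_setU _ _) _; rewrite cards1 leq_add2r.
    apply: leq_trans (leq_card_setU _ _) _.
    by apply: leq_add; apply: leq_imset_card.
  (* Here [D2] plus [cD] gives [2 * (#|D| - #|R0|) <= w + 1]. This suffices for [2 <= w], which
     holds because [a] is active. *)
  move: D2 cD cardM cardB Bw card1.
  move: #|D| #|R0| #|M| #|R1| #|B| #|used C z| => *; lia.
Qed.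

(** Active vertices and witnesses of ready vertices all precede [z]. *)
Lemma eq_forbidden C C' z : (forall v, pos v < pos z -> C v = C' v) ->
  forbidden C z = forbidden C' z.
Proof.
move=> eqC; congr (_ :|: _); apply: eq_in_imset => v; rewrite inE.
  by case/andP => /eqC.
by case/and3P => _ /eqC.
Qed.

Lemma eq_greedy C C' z : (forall v, pos v <= pos z -> C v = C' v) ->
  greedy C z -> greedy C' z.
Proof.
move=> eqC; have eqC1 v : pos v < pos z -> C v = C' v by move/ltnW/eqC.
rewrite /greedy (eq_forbidden eqC1) eqC // => -[nf reuse]; split=> // v vz rv.
rewrite -eqC1 // => /(reuse v vz rv)[u [uz ru rvu ->]].
by exists u; split=> //; rewrite eqC1.
Qed.

End Palette.

(** * Existence and correctness of the greedy coloring *)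

Lemma greedy_ex : exists C : T -> 'I_(5 * w %/ 3), forall a, greedy C a.
Proof.
suff H n : exists C : T -> 'I_(5 * w %/ 3), forall a, pos a < n -> greedy C a.
  have [C grC] := H (\max_v pos v).+1.
  by exists C => a; apply: grC; rewrite ltnS (leq_bigmax a).
elim: n => [|n [C grC]].
  have k_gt0 (v : T) : 0 < 5 * w %/ 3 by have := card_active v; lia.
  by exists (fun v => Ordinal (k_gt0 v)).
have [z /eqP zn|none] := pickP [pred z | pos z == n]; last first.
  exists C => a; rewrite ltnS leq_eqVlt => /orP[|/grC//].
  by have := none a => /= ->.
subst n.
have [c [cf reuse]] : exists c, c \notin forbidden C z /\
    forall v, v \in active z -> ready v z -> C (W v) \notin forbidden C z ->
    exists u, [/\ u \in active z, ready u z, r v <= r u & c = C (W u)].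
  pose P v := [&& v \in active z, ready v z & C (W v) \notin forbidden C z].
  have [u0 Pu0|none] := pickP P.
    case: (@arg_maxnP _ u0 P r Pu0) => u /and3P[uz ru nf] umax.
    exists (C (W u)); split=> // v vz rv vf; exists u; split=> //.
    by apply: umax; apply/and3P.
  have /card_gt0P[c] : 0 < #|~: used C z|.
    have := cardsC (used C z); rewrite card_ord.
    by have := used_bound grC; lia.
  rewrite inE => cu; exists c; split.
    apply: contra cu; rewrite !in_setU => /orP[->//|/imsetP[v]].
    rewrite inE => /and3P[vz rv _] ->; apply/orP; right.
    by apply: (@imset_f _ _ (fun v => C (W v))); rewrite inE vz.
  move=> v vz rv vf; have := none v; by rewrite /P vz rv vf.
pose C' v := if v == z then c else C v.
have eqC v : pos v < pos z -> C v = C' v.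
  by rewrite /C'; case: eqP => // ->; rewrite ltnn.
exists C' => a; rewrite ltnS leq_eqVlt => /orP[/eqP/pos_inj->|az]; last first.
  apply: eq_greedy (grC a az) => v va; apply: eqC.
  exact: leq_ltn_trans va az.
have C'z : C' z = c by rewrite /C' eqxx.
rewrite /greedy -(eq_forbidden eqC) C'z.
split=> // v vz rv; rewrite -eqC // => /(reuse v vz rv)[u [uz ru rvu cu]].
by exists u; split=> //; rewrite -(eqC _ ru).
Qed.

(** Let [y] be another neighbor of [v]. If [y] precedes [v], so does [W v], and the earlier of the
    two is active when the later is colored. If [y] follows [v], the color of [W v] is forbidden for
    [y]. *)
Lemma greedy_CFON (C : T -> 'I_(5 * w %/ 3)) :
  (forall a, greedy C a) -> CFON_coloring e [ffun v => C v].
Proof.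
move=> grC; apply/forallP => v; apply/existsP; exists (C (W v)).
have [evW W1 W2] := WP v.
apply/cards1P; exists (W v); apply/setP => y; rewrite !inE ffunE.
have [->|yW] := eqVneq y (W v); first by rewrite evW eqxx.
apply/negP => /andP[evy /eqP Cy].
have [yv|vy] := ltnP (pos y) (pos v).
  have [Wv _] := W1 y evy yv.
  have ry := adj_tau_r evy; have rW := adj_tau_r evW.
  have [yW'|Wy|/pos_inj eyW] := ltngtP (pos y) (pos (W v)).
  - have /(greedy_active (grC _)) : y \in active (W v).
      by rewrite inE yW' (leq_trans (pos_tau Wv) ry).
    by rewrite Cy eqxx.
  - have /(greedy_active (grC _)) : W v \in active y.
      by rewrite inE Wy (leq_trans (pos_tau yv) rW).
    by rewrite Cy eqxx.
  - by rewrite eyW eqxx in yW.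
have {}vy : pos v < pos y.
  rewrite ltn_neqAle vy andbT; apply: contraTneq evy => /pos_inj <-.
  by rewrite eirr.
have ry : ready v y.
  rewrite /ready; have [/leq_ltn_trans|] := leqP (pos (W v)) (pos v).
    exact.
  move=> /ltnW/W2/(_ y evy); rewrite leq_eqVlt => /orP[/eqP/pos_inj WE|//].
  by rewrite WE eqxx in yW.
have [/negP[]] := grC y; rewrite in_setU; apply/orP; right.
rewrite Cy; apply: (@imset_f _ _ (fun v => C (W v))).
by rewrite inE ry evy inE vy adj_tau_r // esym.
Qed.

End GreedyColoring.

(** * The processing order *)

Section Ordering.

Variables (T : finType) (e : rel T) (tau : T -> nat).
Hypothesis esym : symmetric e.
Hypothesis eirr : irreflexive e.
Hypothesis tau_nbr : forall v, exists2 y, e v y & tau y <= tau v.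

(* The next vertex is a neighbor of the vertex that has no neighbor in the list
   yet, if there is one: it has a neighbor that is not larger, hence minimal
   among the vertices outside the list. *)
Lemma nbr_order_ex : exists pos : T -> nat,
  [/\ injective pos,
      forall a b, pos a < pos b -> tau a <= tau b
    & forall v a, pos v < pos a -> (forall y, e v y -> pos a <= pos y) ->
        e v a].
Proof.
pose needy s v := (v \in s) && ~~ has (e v) s.
pose good s := [/\ uniq s,
  forall x y, x \in s -> y \notin s -> tau x <= tau y,
  forall a b, a \in s -> index b s < index a s -> tau b <= tau a,
  forall a v, a \in s -> index v s < index a s ->
    (forall y, e v y -> index a s <= index y s) -> e v a
& forall x x', needy s x -> needy s x' -> x = x'].
have step s : good s -> size s < #|T| -> exists z, good (rcons s z).
  move=> [us cl mono next nu] sT.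
  have [z [zs zmin znext]] : exists z, [/\ z \notin s,
      forall y, y \notin s -> tau z <= tau y & forall x, needy s x -> e x z].
    have [x nx|none] := pickP (needy s).
      have /andP[xs xn] := nx; have [z exz zx] := tau_nbr x.
      exists z; split.
      - by apply: contra xn => zs; apply/hasP; exists z.
      - by move=> y ys; apply: leq_trans zx (cl _ _ xs ys).
      - by move=> x' /nu/(_ nx) ->.
    have /existsP[z0 z0s] : [exists z, z \notin s].
      rewrite -negb_forall; apply/negP => /forallP sall.
      move: sT; rewrite -(card_uniqP us) ltnNge subset_leq_card //.
      by apply/subsetP => x _; apply: sall.
    case: (@arg_minnP _ z0 [pred z | z \notin s] tau z0s) => z zs zmin.
    exists z; split=> // x nx; by have := none x; rewrite nx.
  have idx x : index x (rcons s z) =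
      if x \in s then index x s else size s + (x != z).
    rewrite -cats1 index_cat /=; case: ifP => // _.
    by rewrite (eq_sym z); case: eqP.
  exists z; split.
  - by rewrite rcons_uniq zs.
  - move=> x y; rewrite !mem_rcons !inE negb_or.
    case/orP => [/eqP ->|xs] /andP[yz ys].
      exact: zmin.
    exact: cl.
  - move=> a b; rewrite mem_rcons inE !idx => /orP[/eqP->|aS].
      rewrite (negPf zs) eqxx addn0; case: ifP => [bs _|_]; last by lia.
      exact: cl.
    rewrite aS; case: ifP => [_|_]; first exact: mono.
    by have := index_size a s; lia.
  - move=> a v; rewrite mem_rcons inE !idx => /orP[/eqP->|aS].
      rewrite (negPf zs) eqxx addn0; case: ifP => [vs _|_]; last by lia.
      move=> far; apply: znext; rewrite /needy vs /=.
      apply/hasPn => y ys; apply/negP => /far; rewrite idx ys leqNgt.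
      by rewrite index_mem ys.
    rewrite aS; case: ifP => [_ va far|_]; last first.
      by have := index_size a s; lia.
    apply: next => // y evy; have := far y evy; rewrite idx.
    case: ifP => // /negbT ys _; rewrite (leq_trans (index_size _ _)) //.
    by rewrite leqNgt index_mem.
  (* A vertex that was needy before has just gained its neighbor [z]. *)
  - suff needyz x : needy (rcons s z) x -> x = z.
      by move=> x x' /needyz-> /needyz.
    rewrite /needy mem_rcons inE has_rcons negb_or => /andP[/orP[/eqP//|xs]].
    case/andP => /negP nxz xn; case: nxz.
    by apply: znext; rewrite /needy xs.
have [s gs sz] : exists2 s, good s & size s = #|T|.
  suff H n : n <= #|T| -> exists2 s, good s & size s = n by apply: H.
  elim: n => [|n IH] nT; first by exists [::].
  have [s gs sn] := IH (ltnW nT).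
  have [|z gz] := step s gs; first by rewrite sn.
  by exists (rcons s z); rewrite // size_rcons sn.
case: gs => us _ mono next _.
have sall x : x \in s.
  apply: contraT => xs; have := max_card (mem (x :: s)).
  by rewrite (card_uniqP _) /= ?xs // sz ltnn.
exists (fun x => index x s); split.
- by move=> a b; apply: index_inj.
- by move=> a b; apply: mono.
- by move=> v a; apply: next.
Qed.

End Ordering.

(** * Life spans from a path decomposition *)

Section FromPathDecomposition.

Variables (T : finType) (e : rel T) (X : seq {set T}).
Hypothesis esym : symmetric e.
Hypothesis noiso : no_isolated e.
Hypothesis pdX : path_decomposition e X.

Definition busy v p :=
  (v \in nth set0 X p) && [exists y, e v y && (y \in nth set0 X p)].

Lemma busy_adj u v : e u v -> exists2 p, busy u p & busy v p.
Proof.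
move=> euv; have [A AX /andP[uA vA]] := pd_edge pdX euv.
have nA : nth set0 X (index A X) = A by rewrite nth_index.
exists (index A X); rewrite /busy nA ?uA ?vA /=; apply/existsP.
  by exists v; rewrite euv.
by exists u; rewrite esym euv.
Qed.

Lemma busy_ex v : exists p, busy v p.
Proof. by have [u evu] := noiso v; have [p] := busy_adj evu; exists p. Qed.

Lemma busy_size v p : busy v p -> p < size X.
Proof.
case/andP => + _; rewrite ltnNge; apply: contraL => /(nth_default _)->.
by rewrite inE.
Qed.

(* Vertices are processed from the first to the last bag that they share with a
   neighbor; dropping them from the other bags leaves at most one vertex
   without neighbors among the processed ones at any moment. *)
Definition first_busy v := ex_minn (busy_ex v).
Definition last_busy v :=
  ex_maxn (busy_ex v) (fun p => @ltnW _ _ \o @busy_size v p).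

Lemma first_busy_le v p : busy v p -> first_busy v <= p.
Proof. by rewrite /first_busy; case: ex_minnP => m _; apply. Qed.

Lemma le_last_busy v p : busy v p -> p <= last_busy v.
Proof. by rewrite /last_busy; case: ex_maxnP => m _; apply. Qed.

Lemma busy_first v : busy v (first_busy v).
Proof. by rewrite /first_busy; case: ex_minnP. Qed.

Lemma busy_last v : busy v (last_busy v).
Proof. by rewrite /last_busy; case: ex_maxnP. Qed.

(** The neighbor that makes [v] busy in a bag is itself busy there. *)
Lemma first_busy_nbr v : exists2 y, e v y & first_busy y <= first_busy v.
Proof.
have /andP[vX /existsP[y /andP[evy yX]]] := busy_first v.
exists y => //; apply: first_busy_le; rewrite /busy yX /=.
by apply/existsP; exists v; rewrite esym evy.
Qed.

(** By the interval property, all these vertices lie in bag [t]. *)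
Lemma busy_load t :
  #|[set v | first_busy v <= t <= last_busy v]| <= (pd_width X).+1.
Proof.
have [tX|Xt] := ltnP t (size X); last first.
  rewrite (_ : [set _ | _] = set0) ?cards0 //; apply/setP => v.
  rewrite !inE; apply/negP => /andP[_].
  by have := busy_size (busy_last v); lia.
apply: (@leq_trans #|nth set0 X t|).
  apply: subset_leq_card; apply/subsetP => v; rewrite inE => tv.
  have /andP[v1 _] := busy_first v; have /andP[v2 _] := busy_last v.
  exact: (pd_interval pdX tv (busy_size (busy_last v)) v1 v2).
apply: leq_trans (leqSpred _) _; rewrite ltnS /pd_width.
exact: (@leq_bigmax_seq _ _ _ (fun A : {set T} => #|A|.-1) _ (mem_nth set0 tX)).
Qed.

End FromPathDecomposition.

Theorem theorem3 (T : finType) (e : rel T)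
    (esym : symmetric e) (eirr : irreflexive e)
    (econn : connected_graph e) (enoiso : no_isolated e) :
  (exists C : {ffun T -> 'I_(5 * (pathwidth e + 1) %/ 3)}, CFON_coloring e C)
  /\ chi_ON enoiso <= 5 * (pathwidth e + 1) %/ 3.
Proof.
suff [C HC] : exists C : {ffun T -> 'I_(5 * (pathwidth e + 1) %/ 3)},
    CFON_coloring e C.
  split; first by exists C.
  by rewrite /chi_ON; case: ex_minnP => m _; apply; apply/existsP; exists C.
have [X pdX wX] : exists2 X, path_decomposition e X & pd_width X = pathwidth e.
  by rewrite /pathwidth; case: ex_minnP => m /asboolP.
set first := first_busy esym enoiso pdX.
set last := last_busy esym enoiso pdX.
have [pos [pos_inj pos_first next]] : exists pos : T -> nat,
    [/\ injective pos, forall a b, pos a < pos b -> first a <= first b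
      & forall v a, pos v < pos a -> (forall y, e v y -> pos a <= pos y) ->
          e v a].
  exact: nbr_order_ex (first_busy_nbr esym enoiso pdX).
have [W WP] := witness_ex last pos enoiso.
have load t : #|[set v | first v <= t <= last v]| <= pathwidth e + 1.
  by rewrite -wX addn1; apply: busy_load.
have first_last v : first v <= last v.
  by apply: first_busy_le; apply: busy_last.
have adj u v : e u v -> first u <= last v.
  case/(busy_adj esym pdX) => p up vp.
  exact: leq_trans (first_busy_le _ _ _ up) (le_last_busy _ _ _ vp).
have [C grC] := greedy_ex esym pos_inj pos_first first_last adj load next WP.
exists [ffun v => C v].
exact: (greedy_CFON esym eirr pos_inj pos_first adj WP grC).
Qed.
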